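(* Let $G$ be a finite simple graph on the vertex set $\{x_1,\dots,x_n\}$, let $K$ be a field, let $J=J(G)\subseteq K[x_1,\dots,x_n]$ be the cover ideal of $G$, and let $\mathbf{m}=x_1x_2\cdots x_n$. Then $G$ contains an odd circuit if and only if $\mathbf{m}\notin J^2$.
   Context: A graph here is a finite hypergraph in which every edge is a set of exactly two vertices. A vertex cover of $G$ is a set of vertices meeting every edge; a set of vertices is identified with the squarefree monomial that is the product of its elements. The cover ideal is $J(G)=(w : w\text{ is a vertex cover of }G)$. An odd circuit is a cycle of odd length in $G$ (not necessarily induced). *)

(* Defs.v *)
From mathcomp Require Import all_boot all_algebra.
From mathcomp Require Import mpoly.

Set Implicit Arguments.
Unset Strict Implicit.
Unset Printing Implicit Defensive.

Import GRing.Theory.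
Local Open Scope ring_scope.

Section Ideals.
Variable R : comNzRingType.

(* Ideals are Prop-valued predicates: unlike the prime and maximal ideals of
   ring_quotient, they are allowed to be the whole ring, as a cover ideal is
   when the graph has no edge. *)
Definition ideal_gen (S : R -> Prop) (x : R) : Prop :=
  exists (k : nat) (a g : 'I_k -> R),
    (forall i, S (g i)) /\ x = \sum_(i < k) a i * g i.

Definition ideal_mul (I J : R -> Prop) : R -> Prop :=
  ideal_gen (fun x => exists f g, [/\ I f, J g & x = f * g]).

Definition ideal_sqr (I : R -> Prop) : R -> Prop := ideal_mul I I.

End Ideals.

Section Graphs.
Variable n : nat.
Implicit Types (E : {set {set 'I_n}}) (W : {set 'I_n}).

(* A graph on 'I_n is its set of edges; the variable x_(i+1) corresponds to
   the vertex i : 'I_n. *)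
Definition simple_graph E : bool := [forall e in E, #|e| == 2%N].

Definition adj E : rel 'I_n := fun u v => [set u; v] \in E.

Definition vertex_cover E W : bool := [forall e in E, W :&: e != set0].

Definition is_circuit E (c : seq 'I_n) : bool :=
  [&& 2 < size c, uniq c & cycle (adj E) c]%N.

Definition has_odd_circuit E : Prop :=
  exists c : seq 'I_n, is_circuit E c /\ odd (size c).

End Graphs.

Section CoverIdeal.
Variables (K : fieldType) (n : nat).

Definition sqfree_mon (W : {set 'I_n}) : {mpoly K[n]} := \prod_(i in W) 'X_i.

Definition cover_ideal (E : {set {set 'I_n}}) : {mpoly K[n]} -> Prop :=
  ideal_gen (fun f => exists W, vertex_cover E W /\ f = sqfree_mon W).

End CoverIdeal.

(* Main.v *)
Require Import Defs.
From mathcomp Require Import all_boot all_algebra.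
From mathcomp Require Import mpoly.

Set Implicit Arguments.
Unset Strict Implicit.
Unset Printing Implicit Defensive.

Import GRing.Theory.
Local Open Scope ring_scope.

(** A monomial occurring in an element of [J^2] is divisible by a product of two
    vertex covers, so the squarefree [x_1 ... x_n] lies in [J^2] exactly when
    there are two disjoint vertex covers, that is, when the graph has a proper
    2-colouring. An odd circuit forbids one. Conversely, colour each vertex by
    whether an odd walk joins it to the root of its component; an edge whose
    ends get the same colour closes an odd walk, and an odd closed walk of
    minimal length is a circuit. *)

Section OddWalks.
Variables (T : finType) (e : rel T).

Lemma not_uniq_split (s : seq T) :
  ~~ uniq s -> exists x p q r, s = p ++ x :: q ++ x :: r.
Proof.
elim: s => //= a s IH; rewrite negb_and negbK => /orP[/splitPr[q r]|/IH].
  by exists a, [::], q, r.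
by move=> [x [p [q [r ->]]]]; exists x, (a :: p), q, r.
Qed.

Lemma cycle_split x (p q : seq T) :
  cycle e (x :: p ++ x :: q) = cycle e (x :: p) && cycle e (x :: q).
Proof. by rewrite /= !rcons_path cat_path last_cat /= -!andbA. Qed.

(** A repeated vertex cuts a closed walk into two shorter closed walks whose lengths add up to an
    odd number, so one of them is odd; induct on the length. *)
Lemma odd_cycle_uniq (c : seq T) : cycle e c -> odd (size c) ->
  exists c', [/\ cycle e c', odd (size c') & uniq c'].
Proof.
have [k] := ubnP (size c); elim: k c => // k IH c lt_ck cyc odd_c.
have [uc|/not_uniq_split[x [p [q [r def_c]]]]] := boolP (uniq c).
  by exists c.
(* Rotate the walk so that it starts at the repeated vertex [x]. *)
move: cyc; rewrite def_c cycle_catC cat_cons -catA cat_cons cycle_split.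
case/andP=> cyc1 cyc2.
have szc : size c = (size (x :: q) + size (x :: r ++ p))%N.
  by rewrite def_c /= !size_cat /= !size_cat /= addnC !addSn !addnS addnA.
move: lt_ck odd_c; rewrite szc oddD ltnS => lt_ck odd_c.
have [odd_q|even_q] := boolP (odd (size (x :: q))).
  by apply: (IH (x :: q)) => //; rewrite (leq_trans _ lt_ck) // addnS ltnS leq_addr.
apply: (IH (x :: r ++ p)) => //; last by rewrite (negPf even_q) in odd_c.
by rewrite (leq_trans _ lt_ck) // addSn ltnS leq_addl.
Qed.

(** The bipartite double cover: every step changes sheet, so the boolean records the parity of the
    length of a walk. *)
Definition double_cover : rel (T * bool) :=
  fun a b => e a.1 b.1 && (a.2 != b.2).

Lemma double_cover_path a (p : seq (T * bool)) : path double_cover a p ->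
  path e a.1 (map fst p) /\ (last a p).2 = a.2 (+) odd (size p).
Proof.
elim: p a => [|b p IH] a /=; first by rewrite addbF.
case/andP=> /andP[-> neq_ab] /IH[-> ->]; split=> //.
by move: neq_ab; case: a.2 b.2 => [] [] //= _; rewrite ?negbK.
Qed.

(** A walk lifts step by step from either sheet; the end sheet [b] depends on the parity of the walk
    chosen, hence the existential. *)
Lemma connect_double_cover u v a : connect e u v ->
  exists b, connect double_cover (u, a) (v, b).
Proof.
case/connectP=> p; elim: p u a => [|w p IH] u a /=; first by move=> _ ->; exists a.
case/andP=> e_uw e_p def_v; have [b con] := IH w (~~ a) e_p def_v; exists b.
by apply: connect_trans con; apply: connect1; rewrite /double_cover e_uw /=; case: a.
Qed.

Lemma connect_double_cover_odd_cycle v :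
  connect double_cover (v, false) (v, true) ->
  exists c, cycle e c /\ odd (size c).
Proof.
(* The walk is nonempty because its ends lie on different sheets. Its last vertex projects back to
   [v] and is dropped, since [cycle] adds the closing step. *)
case/connectP=> p; case/lastP: p => [|p w] //; rewrite last_rcons.
move=> /[swap] <- /double_cover_path[/=]; rewrite map_rcons last_rcons /= size_rcons.
move=> path_p odd_p; exists (v :: map fst p); split=> //=; rewrite size_map.
exact: esym odd_p.
Qed.

Hypothesis e_sym : ssrbool.symmetric e.

Lemma two_coloring_or_odd_cycle :
  (exists W : {set T}, forall u v, e u v -> (u \in W) != (v \in W)) \/
  (exists c, cycle e c /\ odd (size c)).
Proof.
have csym : connect_sym double_cover.
  by apply: sym_connect_sym => a b; rewrite /double_cover e_sym eq_sym.
have csym_e : connect_sym e by exact: sym_connect_sym.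
have [/existsP[v /connect_double_cover_odd_cycle]|/existsPn no_odd] :=
  boolP [exists v, connect double_cover (v, false) (v, true)]; first by right.
left; exists [set v | connect double_cover (fingraph.root e v, false) (v, true)].
move=> u v e_uv; rewrite !inE.
have dc1 a : connect double_cover (u, a) (v, ~~ a).
  by apply: connect1; rewrite /double_cover /= e_uv; case: a.
have <- : fingraph.root e u = fingraph.root e v by apply/(fingraph.rootP csym_e)/connect1.
set r := fingraph.root e u.
have [b rub] : exists b, connect double_cover (r, false) (u, b).
  by apply: connect_double_cover; rewrite csym_e connect_root.
have rvb := connect_trans rub (dc1 b).
have no_both w : connect double_cover (r, false) (w, false) ->
    connect double_cover (r, false) (w, true) -> False.
  by rewrite csym => rwf /(connect_trans rwf); apply/negP.
(* The walk reaches [u] on sheet [b] and [v] on the other one. Equal colours would make both lifts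
   of [v] (if [b] is true) or of [u] (if not) reachable from the root. *)
apply/eqP=> eq_c; case: b rub rvb => rub rvb.
  by apply: (no_both v rvb); rewrite -eq_c.
by apply: (no_both u rub); rewrite eq_c.
Qed.

(** Colours alternate along a walk, so returning to the starting colour takes an even number of
    steps. *)
Lemma even_cycle_of_coloring (W : {set T}) (c : seq T) :
  (forall u v, e u v -> (u \in W) != (v \in W)) -> cycle e c -> ~~ odd (size c).
Proof.
move=> colW; have path_col x p : path e x p ->
    (last x p \in W) = (x \in W) (+) odd (size p).
  elim: p x => [|y p IH] x /=; first by rewrite addbF.
  case/andP=> /colW neq_xy /IH->; move: neq_xy.
  by case: (x \in W) (y \in W) => [] [] //= _; rewrite ?negbK.
case: c => //= x p /path_col; rewrite last_rcons size_rcons /=.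
by case: (x \in W) (odd _) => [] [].
Qed.

End OddWalks.

Section Graphs.
Variables (n : nat) (E : {set {set 'I_n}}).

Lemma adj_sym : ssrbool.symmetric (adj E).
Proof. by move=> u v; rewrite /adj setUC. Qed.

(** The edge meets both covers, and by disjointness in different vertices, so one end lies in [W1]
    and the other in [W2]. *)
Lemma disjoint_covers_coloring (W1 W2 : {set 'I_n}) u v :
  vertex_cover E W1 -> vertex_cover E W2 -> [disjoint W1 & W2] ->
  adj E u v -> (u \in W1) != (v \in W1).
Proof.
move=> /forall_inP cov1 /forall_inP cov2 dis Euv.
have /set0Pn[x] := cov1 _ Euv; have /set0Pn[y] := cov2 _ Euv.
have W2F z : z \in W1 -> z \in W2 = false by exact: disjointFr.
rewrite !inE => /andP[y2 /orP[]/eqP ?] /andP[x1 /orP[]/eqP ?]; subst x y;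
  by apply/eqP=> eq_uv; rewrite W2F // in y2; rewrite -?eq_uv // eq_uv.
Qed.

Hypothesis simpleE : simple_graph E.

Lemma coloring_vertex_cover (W : {set 'I_n}) :
  (forall u v, adj E u v -> (u \in W) != (v \in W)) -> vertex_cover E W.
Proof.
move=> colW; apply/forall_inP=> ed edE; apply/set0Pn.
have /cards2P[u [v [_ def_ed]]] := forall_inP simpleE _ edE.
have := colW u v; rewrite /adj -def_ed => /(_ edE).
have [uW _|_ vW] := boolP (u \in W).
  by exists u; rewrite def_ed !inE uW eqxx.
by exists v; rewrite def_ed !inE eqxx orbT andbT; case: (v \in W) vW.
Qed.

Lemma odd_cycle_has_odd_circuit (c : seq 'I_n) :
  cycle (adj E) c -> odd (size c) -> has_odd_circuit E.
Proof.
move=> cyc /(odd_cycle_uniq cyc)[[|x [|y [|z s]]] [cyc' odd_c u_c]] //.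
  (* Parity leaves length one as the only case below three: a loop, that is, an edge with a single
     element. *)
  move: cyc' => /=; rewrite /adj setUid andbT => /(forall_inP simpleE).
  by rewrite cards1.
by exists (x :: y :: z :: s); rewrite /is_circuit u_c cyc'.
Qed.

Lemma has_odd_circuitP : has_odd_circuit E <->
  ~ exists W1 W2 : {set 'I_n},
      [/\ vertex_cover E W1, vertex_cover E W2 & [disjoint W1 & W2]].
Proof.
split=> [[c [/and3P[_ _ cyc] odd_c]] [W1 [W2 [cov1 cov2 dis]]]|no_cov].
  have colW u v := @disjoint_covers_coloring W1 W2 u v cov1 cov2 dis.
  by move: odd_c; rewrite (negPf (even_cycle_of_coloring colW cyc)).
have [[W colW]|[c [cyc odd_c]]] := two_coloring_or_odd_cycle adj_sym.
  case: no_cov; exists W, (~: W); split; last by rewrite -setI_eq0 setICr.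
    exact: coloring_vertex_cover.
  apply: coloring_vertex_cover => u v /colW; rewrite !inE.
  by case: (u \in W) (v \in W) => [] [].
exact: odd_cycle_has_odd_circuit cyc odd_c.
Qed.

End Graphs.

Section Monomials.
Variables (K : fieldType) (n : nat).
Implicit Types (f g : {mpoly K[n]}) (m : 'X_{1..n}).

Definition set_mnm (W : {set 'I_n}) : 'X_{1..n} := (\sum_(i in W) U_(i))%MM.

Lemma sqfree_monE (W : {set 'I_n}) : sqfree_mon K W = 'X_[set_mnm W].
Proof. by rewrite /sqfree_mon mprodXE. Qed.

Lemma set_mnmE (W : {set 'I_n}) i : set_mnm W i = (i \in W).
Proof.
rewrite /set_mnm mnm_sumE; under eq_bigr do rewrite mnm1E.
have [iW|niW] := boolP (i \in W).
  by rewrite (bigD1 i) //= eqxx big1 // => j /andP[_ /negPf->].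
by rewrite big1 // => j jW; case: eqP niW => // <-; rewrite jW.
Qed.

Lemma ideal_gen_in (R : comNzRingType) (S : R -> Prop) x : S x -> ideal_gen S x.
Proof.
by move=> Sx; exists 1%N, (fun=> 1), (fun=> x); rewrite big_ord1 mul1r.
Qed.

(** A monomial of a combination occurs in some term [a i * g i], hence is a monomial of [a i] times
    one of [g i]. The generators need not be monomials, so this also applies to the products [f * g]
    generating the square. *)
Lemma ideal_gen_msupp (S : {mpoly K[n]} -> Prop) f m : ideal_gen S f ->
  m \in msupp f ->
  exists g m', [/\ S g, m' \in msupp g & (forall i, m' i <= m i)%N].
Proof.
move=> [k [a [g [Sg ->]]]] /msupp_sum_le /flatten_mapP[/= i _].
case/msuppM_le/allpairsP=> -[m1 m2] [/= _ m2g ->].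
by exists (g i), m2; split=> // j; rewrite mnmDE leq_addl.
Qed.

Lemma cover_ideal_msupp E f m : cover_ideal E f -> m \in msupp f ->
  exists2 W, vertex_cover E W & (forall i, (i \in W) <= m i)%N.
Proof.
move=> Jf /(ideal_gen_msupp Jf)[_ [m' [[W [covW ->]]]]].
rewrite sqfree_monE => /mem_msuppXP <- le_m.
by exists W => // i; rewrite -set_mnmE.
Qed.

Lemma ideal_sqr_cover_idealP (E : {set {set 'I_n}}) :
  ideal_sqr (@cover_ideal K n E) (\prod_(i < n) 'X_i) <->
  exists W1 W2 : {set 'I_n},
    [/\ vertex_cover E W1, vertex_cover E W2 & [disjoint W1 & W2]].
Proof.
have -> : \prod_(i < n) 'X_i = 'X_[set_mnm setT] :> {mpoly K[n]}.
  by rewrite -sqfree_monE /sqfree_mon; apply: eq_bigl => i; rewrite inE.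
split=> [J2m|[W1 [W2 [cov1 cov2 dis]]]].
  have /(ideal_gen_msupp J2m) : set_mnm setT \in msupp ('X_[set_mnm setT] : {mpoly K[n]}).
    exact/mem_msuppXP.
  move=> [_ [m' [[f [g [Jf Jg ->]]]]]] /msuppM_le/allpairsP[[m1 m2] /= [m1f m2g ->]] le_m.
  have [W1 cov1 le1] := cover_ideal_msupp Jf m1f.
  have [W2 cov2 le2] := cover_ideal_msupp Jg m2g.
  (* A vertex in both covers would force exponent at least 2 in a squarefree monomial. *)
  exists W1, W2; split=> //; apply/pred0P=> i /=; apply/negP=> /andP[i1 i2].
  have := le_m i; rewrite mnmDE set_mnmE inE leqNgt.
  by have := leq_add (le1 i) (le2 i); rewrite i1 i2 => ->.
(* The cofactor is the product of the vertices outside both covers; by disjointness the three sets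
   partition the vertices. *)
have -> : set_mnm setT = (set_mnm W1 + (set_mnm (~: W1 :\: W2) + set_mnm W2))%MM.
  apply/mnmP=> i; rewrite !mnmDE !set_mnmE !inE.
  by have := disjointFr dis (x := i); case: (i \in W1) (i \in W2) => [] [] // /(_ isT).
exists 1%N, (fun=> 'X_[set_mnm (~: W1 :\: W2)]).
exists (fun=> sqfree_mon K W1 * sqfree_mon K W2); split.
  move=> _; exists (sqfree_mon K W1), (sqfree_mon K W2).
  by split=> //; apply: ideal_gen_in; [exists W1 | exists W2].
by rewrite big_ord1 !sqfree_monE !mpolyXD mulrCA.
Qed.

End Monomials.

Theorem corollary3p15 (K : fieldType) (n : nat) (E : {set {set 'I_n}})
    (simpleE : simple_graph E) :
  has_odd_circuit E <->
  ~ ideal_sqr (@cover_ideal K n E) (\prod_(i < n) 'X_i : {mpoly K[n]}).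
Proof. by rewrite ideal_sqr_cover_idealP; exact: has_odd_circuitP. Qed.
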